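(* Let $\Omega=\{1,2,3\}^{\mathbb N}$ with the shift $\sigma$, and let $A:\Omega\to\mathbb R$ be the potential depending only on the first two coordinates given by $A(x)=-\varepsilon_{x_0x_1}$, where $\varepsilon_{11}=\varepsilon_{22}=0$ and $\varepsilon_{ij}>0$ for every other pair $(i,j)\in\{1,2,3\}^2$. Let $\mathcal P(\beta)$ be the pressure of $\beta A$. Then there exist a positive sub-exponential function $g$ and a positive real number $\rho$ such that $\mathcal P(\beta)=g(\beta)e^{-\rho\beta}$ for $\beta>0$.
   Context: $\sigma(x_0x_1x_2\ldots)=x_1x_2\ldots$. The pressure is $\mathcal P(\beta)=\sup_\mu\{h_\mu+\beta\int A\,d\mu\}$ over $\sigma$-invariant Borel probability measures $\mu$ on $\Omega$, with $h_\mu$ the Kolmogorov(-Sinai) entropy; equivalently $e^{\mathcal P(\beta)}$ is the spectral radius of the $3\times3$ matrix with entries $e^{-\beta\varepsilon_{ij}}$. Sub-exponential means $\frac1\beta\log g(\beta)\to0$ as $\beta\to+\infty$. *)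

(* Defs.v *)
From HB Require Import structures.
From mathcomp Require Import all_boot all_order all_algebra.
From mathcomp Require Import all_classical all_reals all_analysis.
Set Implicit Arguments.
Unset Strict Implicit.
Unset Printing Implicit Defensive.
Import Order.TTheory GRing.Theory Num.Theory.
Import numFieldNormedType.Exports.
Local Open Scope classical_set_scope.
Local Open Scope ring_scope.

Section Entropy.
Context {R : realType} {d : measure_display} {T : measurableType d}.

Definition invariant_measure (f : T -> T) (mu : probability T R) : Prop :=
  forall B : set T, measurable B -> mu (f @^-1` B) = mu B.

(* Cells may be empty: such cells contribute nothing to the entropy. *)
Definition measurable_partition (k : nat) (P : 'I_k -> set T) : Prop :=
  [/\ forall i, measurable (P i),
      trivIset [set: 'I_k] P &
      \bigcup_(i in [set: 'I_k]) P i = [set: T]].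

(* The cell of the refinement P \/ f^-1 P \/ ... \/ f^-(n-1) P with
   itinerary w; every cell of the refinement is of this form. *)
Definition join_cell (f : T -> T) (k : nat) (P : 'I_k -> set T) (n : nat)
    (w : {ffun 'I_n -> 'I_k}) : set T :=
  \bigcap_(i in [set: 'I_n]) (iter i f @^-1` P (w i)).

(* Mathcomp-Analysis sets ln 0 = 0, so that join_entropy uses the usual
   convention 0 log 0 = 0. *)
Definition join_entropy (f : T -> T) (mu : probability T R) (k : nat)
    (P : 'I_k -> set T) (n : nat) : R :=
  - \sum_(w : {ffun 'I_n -> 'I_k})
      fine (mu (join_cell f P w)) * ln (fine (mu (join_cell f P w))).

(* The limit exists whenever mu is f-invariant and P is a measurable
   partition, by subadditivity. *)
Definition partition_entropy (f : T -> T) (mu : probability T R) (k : nat)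
    (P : 'I_k -> set T) : R :=
  limn (fun n : nat => join_entropy f mu P n / n%:R).

Definition KS_entropy (f : T -> T) (mu : probability T R) : \bar R :=
  ereal_sup [set h : \bar R | exists (k : nat) (P : 'I_k -> set T),
    measurable_partition P /\ h = (partition_entropy f mu P)%:E].

Definition pressure (f : T -> T) (A : T -> R) (beta : R) : \bar R :=
  ereal_sup [set p : \bar R | exists mu : probability T R,
    invariant_measure f mu /\
    p = (KS_entropy f mu + beta%:E * \int[mu]_x (A x)%:E)%E].

End Entropy.

(* The symbols 1, 2, 3 of the alphabet are the ordinals 0, 1, 2. *)
Definition symbol : topologicalType := discrete_topology 'I_3.

Definition Omega_top : Type := prod_topology (fun _ : nat => symbol).
HB.instance Definition _ := Topological.on Omega_top.
HB.instance Definition _ := isPointed.Build Omega_top (fun _ => ord0).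

Definition Omega := g_sigma_algebraType (@open Omega_top).

Definition shift_map (x : Omega) : Omega := fun n : nat => x n.+1.

Definition potential {R : realType} (eps : 'I_3 -> 'I_3 -> R) (x : Omega) : R :=
  - eps (x 0%N) (x 1%N).

Definition subexponential {R : realType} (g : R -> R) : Prop :=
  b^-1 * ln (g b) @[b --> +oo%R] --> (0 : R).

(* Main.v *)
Require Import Defs.
From HB Require Import structures.
From mathcomp Require Import all_boot all_order all_algebra.
From mathcomp Require Import all_classical all_reals all_analysis.
From mathcomp Require Import lra ring.
Set Implicit Arguments.
Unset Strict Implicit.
Unset Printing Implicit Defensive.
Import Order.TTheory GRing.Theory Num.Theory.
Import numFieldNormedType.Exports.
Local Open Scope classical_set_scope.
Local Open Scope ring_scope.

(* Upper bound: let M be the matrix with entries e^{-b eps_ij}. If u > 0 and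
   M u <= lam u, then the path weights M_{x_0 x_1} ... M_{x_{n-1} x_n} u_{x_n} /
   (lam^n u_{x_0}) form, up to a constant, a subprobability on words. A finite
   measurable partition agrees, off a set of small measure, with a partition
   into unions of cylinders; so Gibbs' inequality against the image of these
   path weights under a slightly noisy channel bounds its entropy by
   ln lam + b int eps dmu, up to arbitrarily small errors. Hence the pressure is
   at most ln lam. The vector u = (1, e^{-bt}, K e^{-bs}) suggested by linear
   programming duality gives lam = 1 + (1 + K) e^{-rho b} with K bounded for
   large b, where rho is the least mean energy, per visit to the symbols 1 and
   2, of a nontrivial permutation of the alphabet.
   Lower bound: the Markov chain that stays at the symbols 1 and 2 except for
   following the optimal permutation with probability p = e^{-rho b - 1} has
   entropy plus b int A dmu at least p / 2.
   So the pressure is e^{-rho b} up to a factor bounded above and below. *)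

(** * Finite-valued random variables *)

Section FiniteValued.
Context {R : realType} {d : measure_display} {T : measurableType d}.

Definition finite_rv (J : finType) (X : T -> J) : Prop :=
  forall j, measurable (X @^-1` [set j]).

Lemma finite_rv_preimage (J : finType) (X : T -> J) (A : set J) :
  finite_rv X -> measurable (X @^-1` A).
Proof.
move=> hX; rewrite (_ : _ @^-1` _ = \bigcup_(j in A) (X @^-1` [set j])).
  by apply: fin_bigcup_measurable => // j _; exact: hX.
by apply/seteqP; split=> [x Ax|x [j Aj /= xj]]; [exists (X x)|rewrite /preimage /= xj].
Qed.

Lemma finite_rv_comp (J K : finType) (h : J -> K) (X : T -> J) :
  finite_rv X -> finite_rv (h \o X).
Proof. by move=> hX k; rewrite comp_preimage; exact: finite_rv_preimage. Qed.

Lemma finite_rv_pair (J K : finType) (X : T -> J) (Y : T -> K) :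
  finite_rv X -> finite_rv Y -> finite_rv (fun x => (X x, Y x)).
Proof.
move=> hX hY [j k].
rewrite (_ : _ @^-1` _ = (X @^-1` [set j]) `&` (Y @^-1` [set k])).
  by apply: measurableI.
by apply/seteqP; split=> x /= => [[-> ->]|[-> ->]].
Qed.

Lemma finite_rv_ffun (n : nat) (J : finType) (X : 'I_n -> T -> J) :
  (forall i, finite_rv (X i)) ->
  finite_rv (fun x => [ffun i => X i x] : {ffun 'I_n -> J}).
Proof.
move=> hX w.
rewrite (_ : _ @^-1` _ =
  \bigcap_(i in [set: 'I_n]) (X i @^-1` [set w i])).
  by apply: fin_bigcap_measurable => // i _; exact: hX.
apply/seteqP; split=> x /=.
  by move=> <- i _ /=; rewrite ffunE.
by move=> h; apply/ffunP => i; rewrite ffunE; exact: h.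
Qed.

Lemma finite_rv_measurable (J : finType) (X : T -> J) (phi : J -> R) :
  finite_rv X -> measurable_fun [set: T] (phi \o X).
Proof.
move=> hX _ B mB; rewrite setTI comp_preimage.
exact: finite_rv_preimage.
Qed.

Variable mu : probability T R.

Lemma finite_rv_integrable (J : finType) (X : T -> J) (phi : J -> R) :
  finite_rv X -> mu.-integrable [set: T] (EFin \o (phi \o X)).
Proof.
move=> hX; apply: measurable_bounded_integrable => //.
- by rewrite -ge0_fin_numE ?fin_num_measure.
- exact: finite_rv_measurable.
- exists (\sum_j `|phi j|); split; first by rewrite num_real.
  move=> y ly x _ /=; apply: (le_trans _ (ltW ly)).
  by rewrite (bigD1 (X x)) //= lerDl sumr_ge0.
Qed.

Definition law (J : finType) (X : T -> J) (j : J) : R :=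
  fine (mu (X @^-1` [set j])).

Lemma law_ge0 (J : finType) (X : T -> J) (j : J) : 0 <= law X j.
Proof. exact: fine_ge0. Qed.

Lemma finite_rv_integral (J : finType) (X : T -> J) (phi : J -> R) :
  finite_rv X -> \int[mu]_x phi (X x) = \sum_j law X j * phi j.
Proof.
move=> hX; rewrite /Rintegral.
have E x : (phi (X x))%:E =
    (\sum_j (phi j)%:E * (\1_(X @^-1` [set j]) x)%:E)%E.
  rewrite (bigD1 (X x)) //= indicE mem_set //= mule1 big1 ?adde0 // => j jX.
  by rewrite indicE memNset ?mule0 // => /esym/eqP; apply/negP.
under eq_integral do rewrite E.
have I j : mu.-integrable [set: T] (fun x => (\1_(X @^-1` [set j]) x)%:E).
  rewrite (_ : (fun x => _) = EFin \o ((fun k => (k == j)%:R) \o X)).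
    exact: finite_rv_integrable.
  apply/funext => x /=; rewrite indicE; congr (_%:R%:E); congr nat_of_bool.
  by apply/idP/eqP; rewrite inE.
rewrite integral_sum//=; last by move=> j; exact: integrableZl.
rewrite (eq_bigr (fun j => (law X j * phi j)%:E)).
  by rewrite sumEFin.
move=> j _; rewrite integralZl// integral_indic// setIT.
by rewrite /law EFinM fineK ?fin_num_measure // muleC.
Qed.

Lemma law_sum1 (J : finType) (X : T -> J) : finite_rv X -> \sum_j law X j = 1.
Proof.
move=> hX; have := finite_rv_integral (fun=> 1) hX.
rewrite Rintegral_cst // mul1r [X in fine X]probability_setT /= => ->.
by apply: eq_bigr => j _; rewrite mulr1.
Qed.

Lemma gibbs_inequality (J : finType) (X : T -> J) (r : J -> R) :
  finite_rv X -> (forall j, 0 < r j) -> \sum_j r j <= 1 ->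
  - (\sum_j law X j * ln (law X j)) <= \int[mu]_x (- ln (r (X x))).
Proof.
move=> hX r0 r1; rewrite (finite_rv_integral (fun j => - ln (r j)) hX).
rewrite -sumrN -subr_ge0 -sumrB.
apply: (@le_trans _ _ (\sum_j (law X j - r j))).
  by rewrite sumrB law_sum1 // subr_ge0.
apply: ler_sum => j _.
have := law_ge0 X j; rewrite le_eqVlt => /predU1P[<-|p0].
  by rewrite !mul0r oppr0 subr0 sub0r oppr_le0 ltW.
rewrite opprK mulrN [leRHS]addrC -mulrBr -ln_div ?posrE//.
have h : ln (r j / law X j) <= r j / law X j - 1.
  have := @le_ln1Dx R (r j / law X j - 1).
  rewrite addrCA subrr addr0; apply.
  by rewrite ltrBrDl subrr divr_gt0.
have -> : law X j - r j = law X j * - (r j / law X j - 1).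
  by field; rewrite gt_eqF.
rewrite ler_pM2l// -lerN2 opprK (le_trans _ h) //.
by rewrite -lerN2 opprK -!lnV ?posrE ?divr_gt0 // invf_div.
Qed.

End FiniteValued.

(** * Cylinders *)

Definition word (n : nat) (x : Omega) : {ffun 'I_n -> 'I_3} :=
  [ffun i : 'I_n => (x i : 'I_3)].

Definition cylinders : set (set Omega) :=
  [set B | B = set0 \/ exists (n : nat) (w : {ffun 'I_n -> 'I_3}),
    B = word n @^-1` [set w]].

Lemma open_coordinate (i : nat) (a : 'I_3) :
  open ([set x | x i = a] : set Omega_top).
Proof.
rewrite (_ : [set x | _] = proj i @^-1` [set (a : symbol)]) //.
by apply: open_comp; [move=> x _; exact: proj_continuous|exact: discrete_open].
Qed.

Lemma finite_rv_coordinate (i : nat) :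
  finite_rv (fun x : Omega => (x i : 'I_3)).
Proof. by move=> a; apply: sub_sigma_algebra; exact: open_coordinate. Qed.

Lemma finite_rv_word (n : nat) : finite_rv (word n).
Proof. by apply: finite_rv_ffun => i; exact: finite_rv_coordinate. Qed.

Lemma open_contains_cylinder (U : set Omega_top) (x : Omega_top) :
  open U -> U x -> exists n, word n @^-1` [set word n x] `<=` U.
Proof.
move=> oU Ux.
pose F : set_system Omega_top :=
  filter_from [set: nat] (fun n => word n @^-1` [set word n x]).
have FF : Filter F.
  apply: filter_from_filter; first by exists 0%N.
  move=> i j _ _; exists (maxn i j) => // y /= /ffunP wy.
  split; apply/ffunP => k; rewrite !ffunE.
    have lk : (k < maxn i j)%N by rewrite leq_max ltn_ord.
    by have := wy (Ordinal lk); rewrite !ffunE.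
  have lk : (k < maxn i j)%N by rewrite leq_max ltn_ord orbT.
  by have := wy (Ordinal lk); rewrite !ffunE.
have Fx : F --> x.
  apply/cvg_sup => i V [W] [[Q] oQ <-] Qx QV.
  apply: (filterS QV); exists i.+1 => // y /= /ffunP /(_ ord_max).
  by rewrite !ffunE /= => ->.
have [|n _ nU] := Fx U; first exact: open_nbhs_nbhs.
by exists n.
Qed.

Lemma measurable_cylinders : @measurable _ Omega = <<s cylinders >>.
Proof.
apply/seteqP; split; last first.
  apply: smallest_sub; first exact: sigma_algebra_measurable.
  by move=> _ [->//|[n [w ->]]]; exact: finite_rv_word.
apply: smallest_sub; first exact: smallest_sigma_algebra.
move=> U oU.
pose F (nw : {n & {ffun 'I_n -> 'I_3}}) : set Omega :=
  if `[< word (tag nw) @^-1` [set tagged nw] `<=` U >]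
  then word (tag nw) @^-1` [set tagged nw] else set0.
rewrite (_ : U = \bigcup_nw F nw).
  apply: (@countable_bigcupT_measurable _ (g_sigma_algebraType cylinders)).
    exact: countableP.
  move=> [n w]; rewrite /F; case: ifP => _; last exact: measurable0.
  by apply: sub_sigma_algebra; right; exists n, w.
apply/seteqP; split=> [x Ux|x [[n w] _]].
  have [n nU] := open_contains_cylinder oU Ux.
  by exists (existT _ n (word n x)) => //; rewrite /F /= asboolT.
by rewrite /F /=; case: asboolP => // wU; exact: wU.
Qed.

Lemma measurable_to_Omega d (T : measurableType d) (f : T -> Omega) :
  (forall i, finite_rv (fun x => (f x i : 'I_3))) ->
  measurable_fun [set: T] f.
Proof.
move=> hf; apply: (@measurability _ _ T Omega _ _ _ measurable_cylinders).
move=> _ [B + <-].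
rewrite setTI => -[->|[n [w ->]]]; first by rewrite preimage_set0.
have := finite_rv_ffun (fun i : 'I_n => hf i) w.
by congr measurable.
Qed.

Lemma measurable_shift_map : measurable_fun [set: Omega] shift_map.
Proof. by apply: measurable_to_Omega => i; exact: (finite_rv_coordinate i.+1). Qed.

Lemma cylinders_setI_closed : setI_closed cylinders.
Proof.
have le_case n m w v : (n <= m)%N ->
    cylinders (word n @^-1` [set w] `&` word m @^-1` [set v]).
  move=> nm.
  have wE x y : word m x = word m y -> word n x = word n y.
    move=> /ffunP xy; apply/ffunP => i; have := xy (widen_ord nm i).
    by rewrite !ffunE.
  have [[x [/= xw xv]]|h] := pselect
    (exists x, (word n @^-1` [set w] `&` word m @^-1` [set v]) x).
    right; exists m, v; apply/seteqP; split=> y /= => [[]//|yv].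
    by split=> //; rewrite -xw; apply: wE; rewrite yv.
  by left; apply/seteqP; split=> // x Px; apply: h; exists x.
move=> A B [->|[n [w ->]]]; first by left; rewrite set0I.
move=> [->|[m [v ->]]]; first by left; rewrite setI0.
have [|/ltnW] := leqP n m; first exact: le_case.
by rewrite setIC; exact: le_case.
Qed.

Lemma cylinder_measure_unique (R : realType) (m1 m2 : probability Omega R) :
  (forall n (w : {ffun 'I_n -> 'I_3}),
    m1 (word n @^-1` [set w]) = m2 (word n @^-1` [set w])) ->
  forall B : set Omega, measurable B -> m1 B = m2 B.
Proof.
move=> m12; apply: (@measure_unique _ R Omega cylinders (fun=> [set: Omega])
  measurable_cylinders cylinders_setI_closed) => //.
- move=> _; right; exists 0%N, [ffun i => ord0].
  by apply/seteqP; split=> // x _; apply/ffunP => -[].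
- by rewrite bigcup_const.
- by move=> A [->|[n [w ->]]]; [rewrite !measure0|exact: m12].
- by move=> _; rewrite -ge0_fin_numE ?fin_num_measure.
Qed.

Definition determined_by (n : nat) (C : set Omega) : Prop :=
  forall x y, word n x = word n y -> C x -> C y.

Lemma determined_by_leq (n m : nat) (C : set Omega) :
  (n <= m)%N -> determined_by n C -> determined_by m C.
Proof.
move=> nm hC x y /ffunP xy; apply: hC; apply/ffunP => i.
by have := xy (widen_ord nm i); rewrite !ffunE.
Qed.

Lemma determined_by_measurable (n : nat) (C : set Omega) :
  determined_by n C -> measurable C.
Proof.
move=> hC; rewrite (_ : C = word n @^-1` (word n @` C)).
  by apply: finite_rv_preimage; exact: finite_rv_word.
by apply/seteqP; split=> x; [exists x|move=> [y Cy /hC]; exact].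
Qed.

Section Approximation.
Context {R : realType} (mu : probability Omega R).

Definition approximable (B : set Omega) : Prop :=
  measurable B /\ forall e : R, 0 < e -> exists n C,
    determined_by n C /\ (mu ((B `\` C) `|` (C `\` B)) < e%:E)%E.

Lemma approximable_setU (A B : set Omega) :
  approximable A -> approximable B -> approximable (A `|` B).
Proof.
move=> [mA hA] [mB hB]; split; first exact: measurableU.
move=> e e0; have e2 : 0 < e / 2 by rewrite divr_gt0.
have [n [C [nC AC]]] := hA _ e2; have [m [D [mD BD]]] := hB _ e2.
have mC := determined_by_measurable nC.
have mD' := determined_by_measurable mD.
exists (maxn n m), (C `|` D); split.
  move=> x y xy [Cx|Dx]; [left|right].
    exact: (determined_by_leq (leq_maxl n m) nC) Cx.
  exact: (determined_by_leq (leq_maxr n m) mD) Dx.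
have -> : e%:E = ((e / 2)%:E + (e / 2)%:E)%E by rewrite -EFinD -splitr.
apply: le_lt_trans (lteD AC BD).
apply: le_trans (measureU2 _ _ _).
- apply: le_measure; rewrite ?inE.
  + by apply: measurableU; apply: measurableD; apply: measurableU.
  + by apply: measurableU; apply: measurableU; apply: measurableD.
  + by move=> x /=; tauto.
- by apply: measurableU; apply: measurableD.
- by apply: measurableU; apply: measurableD.
Qed.

Lemma measurable_approximable (B : set Omega) : measurable B -> approximable B.
Proof.
have approximable0 : approximable set0.
  split=> // e e0; exists 0%N, set0; split=> //.
  by rewrite setDv set0U measure0 lte_fin.
rewrite [X in X B -> _]measurable_cylinders; apply; split; last first.
  move=> B' [->//|[n [w ->]]]; split; first exact: finite_rv_word.
  move=> e e0; exists n, (word n @^-1` [set w]); split.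
    by move=> x y /= ->.
  by rewrite setDv set0U measure0 lte_fin.
split=> //.
  move=> A [mA hA]; split; first by apply: measurableD.
  move=> e /hA[n [C [nC AC]]]; exists n, (~` C); split.
    by move=> x y /esym xy nCx /(nC _ _ xy).
  rewrite (_ : _ `|` _ = (A `\` C) `|` (C `\` A)) //.
  apply/seteqP; split=> x /=; first by have := EM (A x); have := EM (C x); tauto.
  by tauto.
move=> A hA; have mA k : measurable (A k) by have [] := hA k.
split; first exact: bigcupT_measurable.
move=> e e0; have e2 : 0 < e / 2 by rewrite divr_gt0.
pose F m := \big[setU/set0]_(k < m.+1) A k.
have FE m : approximable (F m).
  by rewrite /F; elim/big_ind: _ => // C D; exact: approximable_setU.
have mF m : measurable (F m) by have [] := FE m.
have FU : \bigcup_m F m = \bigcup_k A k by rewrite bigcup_bigsetU_bigcup.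
have mU : measurable (\bigcup_k A k) by exact: bigcupT_measurable.
have ndF : nondecreasing_seq F by move=> i j ij; apply/subsetPset; exact: subset_bigsetU.
have cF : mu (F m) @[m --> \oo] --> mu (\bigcup_k A k).
  by rewrite -FU; apply: nondecreasing_cvg_mu => //; rewrite FU.
have [m Fm] : exists m, (mu (\bigcup_k A k `\` F m) < (e / 2)%:E)%E.
  have /fine_cvgP[_ /cvgrPdist_lt /(_ _ e2)[m _ /(_ m (leqnn m)) h]] :
      mu (F m) @[m --> \oo] --> (fine (mu (\bigcup_k A k)))%:E.
    by rewrite fineK ?fin_num_measure.
  exists m; rewrite measureD //; last by rewrite -ge0_fin_numE ?fin_num_measure.
  rewrite setIidr; last by rewrite -FU; exact: bigcup_sup.
  move: h => /= /(le_lt_trans (ler_norm _)).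
  by rewrite -lte_fin EFinB !fineK ?fin_num_measure.
have [n [C [nC FC]]] := (FE m).2 _ e2.
have mC := determined_by_measurable nC.
exists n, C; split=> //.
have -> : e%:E = ((e / 2)%:E + (e / 2)%:E)%E by rewrite -EFinD -splitr.
apply: le_lt_trans (lteD Fm FC).
apply: le_trans (measureU2 _ _ _).
- apply: le_measure; rewrite ?inE.
  + by apply: measurableU; apply: measurableD.
  + by apply: measurableU; [|apply: measurableU]; apply: measurableD.
  + have FA x : F m x -> (\bigcup_k A k) x by rewrite -FU => ?; exists m.
    by move=> x /=; have := EM (F m x); have := FA x; tauto.
- by apply: measurableD.
- by apply: measurableU; apply: measurableD.
Qed.

End Approximation.

Definition prepend (a : 'I_3) (x : Omega) : Omega :=
  fun n => if n is m.+1 then x m else a.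

Definition extend (n : nat) (w : {ffun 'I_n -> 'I_3}) : Omega :=
  fun i => if insub i is Some k then w k else ord0.

Lemma extend_ord (n : nat) (w : {ffun 'I_n -> 'I_3}) (i : 'I_n) :
  extend w i = w i.
Proof. by rewrite /extend valK. Qed.

Lemma word_extend (n : nat) (w : {ffun 'I_n -> 'I_3}) : word n (extend w) = w.
Proof. by apply/ffunP => i; rewrite ffunE extend_ord. Qed.

Lemma extend_word (n : nat) (x : Omega) (i : nat) :
  (i < n)%N -> extend (word n x) i = x i.
Proof. by move=> ni; have := extend_ord (word n x) (Ordinal ni); rewrite ffunE. Qed.

Lemma sum_extend_recl (V : nmodType) (n : nat) (F : Omega -> V) :
  \sum_(w : {ffun 'I_n.+1 -> 'I_3}) F (extend w) =
  \sum_(a : 'I_3) \sum_(v : {ffun 'I_n -> 'I_3}) F (prepend a (extend v)).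
Proof.
rewrite pair_big /=.
pose c (p : 'I_3 * {ffun 'I_n -> 'I_3}) : {ffun 'I_n.+1 -> 'I_3} :=
  [ffun i => if unlift ord0 i is Some j then p.2 j else p.1].
pose s (w : {ffun 'I_n.+1 -> 'I_3}) : 'I_3 * {ffun 'I_n -> 'I_3} :=
  (w ord0, [ffun i => w (lift ord0 i)]).
rewrite (reindex c) /=; last first.
  exists s => [[a v] _|w _].
    by congr pair; [|apply/ffunP => i]; rewrite !ffunE ?unlift_none ?liftK.
  by apply/ffunP => i; rewrite ffunE; case: unliftP => [j|] ->; rewrite ?ffunE.
apply: eq_bigr => -[a v] _; congr (F _); apply: functional_extensionality_dep => -[|i].
  have := extend_ord (c (a, v)) ord0.
  by rewrite ffunE unlift_none.
rewrite /= /extend; case: insubP => [j /= ji jE|].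
  case: insubP => [k ki kE|]; last by rewrite -ltnS ji.
  rewrite ffunE (_ : j = lift ord0 k) ?liftK //.
  by apply: val_inj; rewrite /= jE /bump /= kE.
by case: insubP => //= j + _; rewrite -ltnS => ->.
Qed.

Lemma iter_shift_mapE (i n : nat) (x : Omega) :
  iter i shift_map x n = x (i + n)%N.
Proof.
elim: i n => // i IH n.
by rewrite iterS -[LHS]/(iter i shift_map x n.+1) IH addSnnS.
Qed.

Section RandomVariablesAndInvariance.
Context {R : realType} {d : measure_display} {T : measurableType d}.
Variable mu : probability T R.

Lemma Rintegral_sum (n : nat) (f : 'I_n -> T -> R) :
  (forall i, mu.-integrable [set: T] (EFin \o f i)) ->
  \int[mu]_x (\sum_i f i x) = \sum_i \int[mu]_x f i x.
Proof.
move=> hf; rewrite /Rintegral.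
under eq_integral do rewrite -sumEFin.
rewrite integral_sum // -[RHS]/(fine (_%:E)) -sumEFin; congr fine.
by apply: eq_bigr => i _; rewrite fineK //; apply: integrable_fin_num => //; exact: hf.
Qed.

Lemma integrable_Rsum (n : nat) (f : 'I_n -> T -> R) :
  (forall i, mu.-integrable [set: T] (EFin \o f i)) ->
  mu.-integrable [set: T] (EFin \o (fun x => \sum_i f i x)).
Proof.
move=> hf; rewrite (_ : _ \o _ = fun x => (\sum_i (f i x)%:E)%E).
  by apply: integrable_sum => // i _; exact: hf.
by apply/funext => x /=; rewrite sumEFin.
Qed.

Lemma finite_rv_map (f : T -> T) (J : finType) (X : T -> J) :
  measurable_fun [set: T] f -> finite_rv X -> finite_rv (X \o f).
Proof.
by move=> mf hX j; rewrite comp_preimage -[X in measurable X]setTI; exact: mf.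
Qed.

Lemma measurable_iter (f : T -> T) (n : nat) :
  measurable_fun [set: T] f -> measurable_fun [set: T] (iter n f).
Proof.
move=> mf; elim: n => [|n IH]; first exact: measurable_id.
exact: measurableT_comp.
Qed.

Lemma law_iter (f : T -> T) (n : nat) (J : finType) (X : T -> J) :
  measurable_fun [set: T] f -> invariant_measure f mu -> finite_rv X ->
  law mu (X \o iter n f) = law mu X.
Proof.
move=> mf inv hX; elim: n => // n IH; rewrite -IH; apply/funext => j.
rewrite /law; congr fine.
have := inv _ (finite_rv_map (measurable_iter n mf) hX j).
rewrite -comp_preimage => <-; congr (mu _).
by apply/seteqP; split=> x; rewrite /preimage /= -iterSr.
Qed.

Lemma Rintegral_iter (f : T -> T) (n : nat) (J : finType) (X : T -> J)
    (phi : J -> R) :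
  measurable_fun [set: T] f -> invariant_measure f mu -> finite_rv X ->
  \int[mu]_x phi (X (iter n f x)) = \int[mu]_x phi (X x).
Proof.
move=> mf inv hX.
have hXn := finite_rv_map (measurable_iter n mf) hX.
by rewrite (finite_rv_integral mu _ hX) (finite_rv_integral mu _ hXn) law_iter.
Qed.

End RandomVariablesAndInvariance.

Lemma ln_prod (R : realType) (n : nat) (F : 'I_n -> R) :
  (forall i, 0 < F i) -> ln (\prod_i F i) = \sum_i ln (F i).
Proof.
elim: n F => [|n IH] F F0; first by rewrite !big_ord0 ln1.
by rewrite !big_ord_recl lnM ?posrE ?prodr_gt0 // IH.
Qed.

(** * Upper bound on the entropy *)

Section PathWeights.
Context {R : realType} (M : 'I_3 -> 'I_3 -> R).

Definition path_weight (n : nat) (x : Omega) : R :=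
  \prod_(i < n) M (x i) (x i.+1).

Lemma path_weight_prepend (n : nat) (a : 'I_3) (x : Omega) :
  path_weight n.+1 (prepend a x) = M a (x 0%N) * path_weight n x.
Proof. by rewrite /path_weight big_ord_recl. Qed.

Lemma eq_path_weight (n : nat) (x y : Omega) :
  (forall i, (i <= n)%N -> x i = y i) -> path_weight n x = path_weight n y.
Proof. by move=> xy; apply: eq_bigr => i _; rewrite !xy // ltnW. Qed.

Hypothesis M_gt0 : forall a b, 0 < M a b.

Lemma path_weight_gt0 (n : nat) (x : Omega) : 0 < path_weight n x.
Proof. by apply: prodr_gt0. Qed.

Variables (u : 'I_3 -> R) (lam : R).
Hypothesis lam_gt0 : 0 < lam.
Hypothesis u_gt0 : forall a, 0 < u a.
Hypothesis Mu_le : forall a, \sum_b M a b * u b <= lam * u a.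

Lemma sum_path_weight_from (n : nat) (a : 'I_3) :
  \sum_(v : {ffun 'I_n -> 'I_3}) path_weight n (prepend a (extend v)) *
    u (prepend a (extend v) n) <= lam ^+ n * u a.
Proof.
elim: n a => [|n IH] a.
  rewrite (big_pred1 [ffun=> ord0]) /=; last first.
    by move=> v; apply/esym/eqP/ffunP => -[].
  by rewrite /path_weight big_ord0.
rewrite (sum_extend_recl n (fun y => path_weight n.+1 (prepend a y) *
  u (prepend a y n.+1))).
apply: (@le_trans _ _ (\sum_b M a b * (lam ^+ n * u b))).
  apply: ler_sum => b _; apply: le_trans (ler_wpM2l (ltW (M_gt0 a b)) (IH b)).
  rewrite mulr_sumr; apply: ler_sum => v _.
  by rewrite path_weight_prepend mulrA.
under eq_bigr do rewrite mulrCA.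
by rewrite -mulr_sumr exprSr -mulrA ler_wpM2l // exprn_ge0 // ltW.
Qed.

Definition path_mass (n : nat) (x : Omega) : R :=
  path_weight n x * u (x n) / (lam ^+ n * u (x 0%N) * 3).

Lemma path_mass_gt0 (n : nat) (x : Omega) : 0 < path_mass n x.
Proof. by rewrite divr_gt0 ?mulr_gt0 ?exprn_gt0 // path_weight_gt0. Qed.

Lemma sum_path_mass (n : nat) :
  \sum_(v : {ffun 'I_n.+1 -> 'I_3}) path_mass n (extend v) <= 1.
Proof.
rewrite (sum_extend_recl n (path_mass n)).
apply: (@le_trans _ _ (\sum_(a : 'I_3) 3^-1)); last first.
  by rewrite sumr_const card_ord -[_ *+ _]mulr_natl divff.
apply: ler_sum => a _; rewrite /path_mass /= -mulr_suml.
rewrite ler_pdivrMr ?mulr_gt0 ?exprn_gt0 //.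
by rewrite mulrC mulfK // sum_path_weight_from.
Qed.

Lemma ln_path_mass (n : nat) (x : Omega) :
  - ln (path_mass n x) <= \sum_(i < n) - ln (M (x i) (x i.+1)) +
    (n%:R * ln lam + (ln 3 + 2 * \sum_a `|ln (u a)|)).
Proof.
have lnu a : `|ln (u a)| <= \sum_a `|ln (u a)|.
  by rewrite (bigD1 a) //= lerDl sumr_ge0.
have := lnu (x n); have := lnu (x 0%N); rewrite !ler_norml => /andP[_ h0] /andP[h1 _].
rewrite ln_div ?posrE ?mulr_gt0 ?exprn_gt0 ?path_weight_gt0 //.
rewrite !lnM ?posrE ?mulr_gt0 ?exprn_gt0 ?path_weight_gt0 //.
rewrite lnXn // ln_prod // sumrN -[ln lam *+ n]mulr_natl.
by lra.
Qed.

End PathWeights.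

Section EntropyUpperBound.
Context {R : realType} (mu : probability Omega R).

Lemma partition_index d (T : measurableType d) (k : nat) (P : 'I_k -> set T) :
  measurable_partition P ->
  exists2 p : T -> 'I_k, finite_rv p & forall j, p @^-1` [set j] = P j.
Proof.
move=> [mP tP UP].
have hp x : {j | P j x}.
  by apply: cid; have : [set: T] x by []; rewrite -UP => -[j _]; exists j.
have E j : (fun x => projT1 (hp x)) @^-1` [set j] = P j.
  apply/seteqP; split=> x /= => [<-|Px]; first exact: (projT2 (hp x)).
  by apply: (tP _ _ I I); exists x; split=> //; exact: (projT2 (hp x)).
by exists (fun x => projT1 (hp x)) => // j; rewrite E.
Qed.

Lemma law_join_cell d (T : measurableType d) (nu : probability T R)
    (f : T -> T) (k n : nat) (P : 'I_k -> set T) (p : T -> 'I_k) :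
  (forall j, p @^-1` [set j] = P j) ->
  forall w : {ffun 'I_n -> 'I_k}, fine (nu (join_cell f P w)) =
    law nu (fun x => [ffun i : 'I_n => p (iter i f x)] : {ffun 'I_n -> 'I_k}) w.
Proof.
move=> hp w; rewrite /law; congr (fine (nu _)).
apply/seteqP; split=> x /=.
  by move=> hx; apply/ffunP => i; rewrite ffunE; have := hx i I; rewrite -hp.
by move=> /ffunP hx i _; rewrite -hp /preimage /= -hx ffunE.
Qed.

Lemma approximate_index (k : nat) (p : Omega -> 'I_k) (e : R) :
  finite_rv p -> 0 < e -> exists N (f : Omega -> 'I_k),
    (forall x y, word N x = word N y -> f x = f y) /\
    fine (mu [set x | f x != p x]) <= e.
Proof.
move=> hp e0; pose x0 : Omega := fun=> ord0.
have k0 : 0 < k%:R :> R by rewrite ltr0n (leq_trans _ (ltn_ord (p x0))).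
have ek : 0 < e / k%:R by rewrite divr_gt0.
have hA j := (measurable_approximable mu (hp j)).2 _ ek.
have [N hN] := choice hA; have [C hC] := choice hN.
pose N' := \max_j N j.
have dC j : determined_by N' (C j).
  by apply: determined_by_leq (hC j).1; exact: leq_bigmax.
have mC j := determined_by_measurable (dC j).
pose D j := (p @^-1` [set j] `\` C j) `|` (C j `\` p @^-1` [set j]).
have mD j : measurable (D j) by apply: measurableU; apply: measurableD.
pose f x := if [pick j | `[< C j x >]] is Some j then j else p x0.
have fN x y : word N' x = word N' y -> f x = f y.
  move=> xy; rewrite /f; congr (if _ is Some j then j else _).
  apply: eq_pick => j; apply/asboolP/asboolP; first exact: dC.
  by apply: dC; rewrite xy.
exists N', f; split=> //.
have sub : [set x | f x != p x] `<=` \big[setU/set0]_j D j.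
  move=> x /= fp; rewrite -bigcup_seq; apply: contrapT => nD.
  have Dj j : p x = j <-> C j x.
    have nDj : ~ D j x by move=> Dj; apply: nD; exists j; rewrite //= mem_index_enum.
    by move: nDj; rewrite /D /=; have := EM (C j x); have := EM (p x = j); tauto.
  move/eqP: fp; apply; rewrite /f; case: pickP => [j /asboolP /Dj //|].
  by move=> /(_ (p x)) /asboolP []; apply/Dj.
have [mU leU] : measurable (\big[setU/set0]_j D j) /\
    (mu (\big[setU/set0]_j D j) <= \sum_j mu (D j))%E.
  elim/big_rec2: _ => [|j s A _ [mA As]]; first by rewrite measure0.
  split; first exact: measurableU.
  by apply: le_trans (measureU2 _ (mD j) mA) _; exact: leeD2l.
have hf : finite_rv f.
  by move=> j; apply: (determined_by_measurable (n := N')) => x y xy /= <-;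
    exact/esym/fN.
have mbad : measurable [set x | f x != p x].
  have := finite_rv_preimage [set jl : 'I_k * 'I_k | jl.1 != jl.2]
    (finite_rv_pair hf hp).
  by congr measurable.
rewrite -lee_fin fineK ?fin_num_measure //.
apply: (@le_trans _ _ (mu (\big[setU/set0]_j D j))).
  by apply: le_measure; rewrite ?inE.
apply: (le_trans leU).
apply: (@le_trans _ _ (\sum_(j < k) (e / k%:R)%:E)%E).
  by apply: lee_sum => j _; apply/ltW; exact: (hC j).2.
rewrite sumEFin lee_fin sumr_const card_ord -[_ *+ _]mulr_natr.
by rewrite divfK // gt_eqF.
Qed.

Lemma finite_rv_determined (N k : nat) (f : Omega -> 'I_k) :
  (forall x y, word N x = word N y -> f x = f y) -> finite_rv f.
Proof.
move=> fN j; apply: (determined_by_measurable (n := N)) => x y xy /= <-.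
exact/esym/fN.
Qed.

Context (M : 'I_3 -> 'I_3 -> R) (u : 'I_3 -> R) (lam : R).
Hypothesis M_gt0 : forall a b, 0 < M a b.
Hypothesis lam_gt0 : 0 < lam.
Hypothesis u_gt0 : forall a, 0 < u a.
Hypothesis Mu_le : forall a, \sum_b M a b * u b <= lam * u a.
Hypothesis mu_inv : invariant_measure shift_map mu.

Definition mean_weight : R := \int[mu]_x - ln (M (x 0%N) (x 1%N)).

Section FixedApproximation.
Context (k : nat) (P : 'I_k -> set Omega) (p f : Omega -> 'I_k) (N : nat).
Hypothesis hp : finite_rv p.
Hypothesis pP : forall j, p @^-1` [set j] = P j.
Hypothesis fN : forall x y, word N x = word N y -> f x = f y.
Variable eta : R.
Hypothesis eta01 : 0 < eta < 1.

Let k_gt0 : 0 < k%:R :> R.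
Proof. by rewrite ltr0n (leq_trans _ (ltn_ord (p (fun=> ord0)))). Qed.

Definition channel (a b : 'I_k) : R := if a == b then 1 - eta else eta / k%:R.

Lemma channel_gt0 (a b : 'I_k) : 0 < channel a b.
Proof.
have /andP[e0 e1] := eta01; rewrite /channel.
by case: eqP => _; rewrite ?subr_gt0 ?divr_gt0.
Qed.

Lemma sum_channel (a : 'I_k) : \sum_b channel a b <= 1.
Proof.
have /andP[e0 e1] := eta01.
apply: (@le_trans _ _ (\sum_b ((1 - eta) * (a == b)%:R + eta / k%:R))).
  apply: ler_sum => b _; rewrite /channel; case: eqP => _.
    by rewrite mulr1 lerDl ltW // divr_gt0.
  by rewrite mulr0 add0r.
rewrite big_split /= sumr_const card_ord -[_ *+ _]mulr_natr divfK ?gt_eqF //.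
rewrite -mulr_sumr (bigD1 a) //= eqxx big1 ?addr0 ?mulr1 ?subrK //.
by move=> b /negPf; rewrite eq_sym => ->.
Qed.

Definition joint_mass (n : nat) (v : {ffun 'I_(n + N).+1 -> 'I_3})
    (w : {ffun 'I_n -> 'I_k}) : R :=
  path_mass M u lam (n + N) (extend v) *
  \prod_(i < n) channel (f (iter i shift_map (extend v))) (w i).

Lemma joint_mass_gt0 n v w : 0 < joint_mass (n := n) v w.
Proof.
rewrite mulr_gt0 ?path_mass_gt0 // prodr_gt0 // => i _; exact: channel_gt0.
Qed.

Definition itinerary_mass (n : nat) (w : {ffun 'I_n -> 'I_k}) : R :=
  \sum_v joint_mass v w.

Lemma joint_le_itinerary n (v : {ffun 'I_(n + N).+1 -> 'I_3}) w :
  joint_mass v w <= itinerary_mass (n := n) w.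
Proof.
rewrite /itinerary_mass (bigD1 v) //= lerDl sumr_ge0 // => v' _.
by rewrite ltW // joint_mass_gt0.
Qed.

Lemma sum_itinerary_mass n : \sum_w itinerary_mass (n := n) w <= 1.
Proof.
rewrite exchange_big /=.
apply: le_trans (sum_path_mass M_gt0 lam_gt0 u_gt0 Mu_le (n + N)).
apply: ler_sum => v _; rewrite /joint_mass -mulr_sumr.
rewrite -[leRHS]mulr1 ler_wpM2l //; first exact/ltW/path_mass_gt0.
rewrite -(bigA_distr_bigA (fun i : 'I_n => channel (f (iter i shift_map (extend v))))).
apply: prodr_ile1 => i _; rewrite sum_channel andbT sumr_ge0 // => b _.
exact/ltW/channel_gt0.
Qed.

Let itinerary (n : nat) (x : Omega) : {ffun 'I_n -> 'I_k} :=
  [ffun i : 'I_n => p (iter i shift_map x)].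

Let hit (b : bool) : R := if b then - ln (1 - eta) else - ln (eta / k%:R).

Lemma ln_joint_mass (n : nat) (x : Omega) :
  - ln (joint_mass (word (n + N).+1 x) (itinerary n x)) <=
  \sum_(i < n + N) - ln (M (x i) (x i.+1)) +
  \sum_(i < n) hit (f (iter i shift_map x) == p (iter i shift_map x)) +
  ((n + N)%:R * ln lam + (ln 3 + 2 * \sum_a `|ln (u a)|)).
Proof.
have xE i : (i <= n + N)%N -> extend (word (n + N).+1 x) i = x i.
  by move=> iN; rewrite extend_word.
rewrite lnM ?posrE ?path_mass_gt0 ?prodr_gt0 //; last first.
  by move=> i _; exact: channel_gt0.
rewrite ln_prod; last by move=> i; exact: channel_gt0.
rewrite (_ : path_mass M u lam (n + N) _ = path_mass M u lam (n + N) x); last first.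
  by rewrite /path_mass !xE // (eq_path_weight M xE).
rewrite opprD -sumrN addrAC.
apply: lerD; first exact: ln_path_mass.
apply: ler_sum => i _; rewrite ffunE /channel.
rewrite (_ : f (iter i shift_map (extend _)) = f (iter i shift_map x)); last first.
  apply: fN; apply/ffunP => j; rewrite !ffunE !iter_shift_mapE xE //.
  by rewrite leq_add // ltnW.
by rewrite /hit; case: eqP.
Qed.

Lemma join_entropy_le (n : nat) :
  join_entropy shift_map mu P n <=
  n%:R * (ln lam + mean_weight - ln (1 - eta) -
          fine (mu [set x | f x != p x]) * ln (eta / k%:R)) +
  (N%:R * (ln lam + mean_weight) + (ln 3 + 2 * \sum_a `|ln (u a)|)).
Proof.
have hf := finite_rv_determined fN.
have mS := measurable_shift_map.
have hit_rv i := finite_rv_map (measurable_iter i mS) hp.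
have hI : finite_rv (itinerary n) by apply: finite_rv_ffun => i; exact: hit_rv.
rewrite /join_entropy.
under eq_bigr do rewrite (law_join_cell mu shift_map pP).
apply: (le_trans (gibbs_inequality mu hI _ (sum_itinerary_mass n))).
  move=> w; apply: lt_le_trans (joint_le_itinerary [ffun=> ord0] w).
  exact: joint_mass_gt0.
pose X (x : Omega) : 'I_3 * 'I_3 := (x 0%N, x 1%N).
have hX : finite_rv X by apply: finite_rv_pair; exact: finite_rv_coordinate.
pose Z (x : Omega) : bool := f x == p x.
have hZ : finite_rv Z.
  exact: (finite_rv_comp (fun ab : 'I_k * 'I_k => ab.1 == ab.2)
    (finite_rv_pair hf hp)).
pose A (i : 'I_(n + N)) (x : Omega) : R :=
  (fun ab : 'I_3 * 'I_3 => - ln (M ab.1 ab.2)) (X (iter i shift_map x)).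
pose B (i : 'I_n) (x : Omega) : R := hit (Z (iter i shift_map x)).
have iA i : mu.-integrable [set: Omega] (EFin \o A i).
  exact: (finite_rv_integrable mu (fun ab => - ln (M ab.1 ab.2))
    (finite_rv_map (measurable_iter i mS) hX)).
have iB i : mu.-integrable [set: Omega] (EFin \o B i).
  exact: (finite_rv_integrable mu hit (finite_rv_map (measurable_iter i mS) hZ)).
pose c0 : R := (n + N)%:R * ln lam + (ln 3 + 2 * \sum_a `|ln (u a)|).
have ic : mu.-integrable [set: Omega] (EFin \o (fun=> c0)).
  exact: (finite_rv_integrable mu (fun=> c0) hZ).
have iAs := integrable_Rsum iA; have iBs := integrable_Rsum iB.
have iAB : mu.-integrable [set: Omega]
    (EFin \o (fun x => \sum_i A i x + \sum_i B i x)).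
  exact: (integrableD _ iAs iBs).
have iABc : mu.-integrable [set: Omega]
    (EFin \o (fun x => \sum_i A i x + \sum_i B i x + c0)).
  exact: (integrableD _ iAB ic).
apply: (@le_trans _ _ (\int[mu]_x (\sum_i A i x + \sum_i B i x + c0))).
  apply: le_Rintegral => //.
    exact: (finite_rv_integrable mu (fun w => - ln (itinerary_mass w)) hI).
  move=> x _; have s0 := joint_mass_gt0 (word (n + N).+1 x) (itinerary n x).
  apply: (@le_trans _ _ (- ln (joint_mass (word (n + N).+1 x) (itinerary n x)))).
    by rewrite lerN2 ler_ln ?posrE ?joint_le_itinerary //
      (lt_le_trans s0) ?joint_le_itinerary.
  apply: (le_trans (ln_joint_mass _ _)).
  rewrite lerD2r lerD2r; apply: ler_sum => i _.
  by rewrite /A /X /= !iter_shift_mapE addn0 addn1.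
rewrite RintegralD // RintegralD // !Rintegral_sum //.
rewrite (eq_bigr (fun=> mean_weight)); last first.
  by move=> i _; rewrite /A (Rintegral_iter i
    (fun ab => - ln (M ab.1 ab.2)) mS mu_inv hX).
rewrite [X in _ + X + _](eq_bigr (fun=> \int[mu]_x hit (Z x))); last first.
  by move=> i _; rewrite /B (Rintegral_iter i hit mS mu_inv hZ).
rewrite !sumr_const !card_ord Rintegral_cst // [X in fine X]probability_setT mulr1.
rewrite (finite_rv_integral mu hit hZ) big_bool /=.
have -> : law mu Z false = fine (mu [set x | f x != p x]).
  congr (fine (mu _)); apply/seteqP; split=> x /=; rewrite /Z; first by move=> ->.
  by move/negPf.
have t1 : law mu Z true <= 1.
  by rewrite -(law_sum1 mu hZ) big_bool /= lerDl law_ge0.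
have /andP[e0 e1] := eta01.
have ln0 : 0 <= - ln (1 - eta) by rewrite oppr_ge0 ln_le0 // gerBl ltW.
rewrite -[mean_weight *+ _]mulr_natl -[(_ + _) *+ _]mulr_natl /c0 natrD.
set bad := fine _; set S := \sum_a _; set lt := law mu Z true in t1 *.
have h := ler_wpM2l (ler0n R n) (ler_wpM2r ln0 t1).
by lra.
Qed.

End FixedApproximation.

Lemma partition_entropy_le (k : nat) (P : 'I_k -> set Omega) :
  measurable_partition P ->
  cvgn (fun n => join_entropy shift_map mu P n / n%:R) ->
  partition_entropy shift_map mu P <= ln lam + mean_weight.
Proof.
move=> /partition_index[p hp pP] cP; apply/ler_addgt0Pr => e e0.
have k1 : 1 <= k%:R :> R.
  by rewrite ler1n (leq_trans _ (ltn_ord (p (fun=> ord0)))).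
pose eta : R := 1 - expR (- (e / 2)).
have eta01 : 0 < eta < 1.
  rewrite subr_gt0 gtrBl expR_gt0 andbT -expR0 ltr_expR oppr_lt0.
  by rewrite divr_gt0.
have /andP[eta0 eta1] := eta01.
have etak : 0 < - ln (eta / k%:R).
  have k0 := lt_le_trans ltr01 k1.
  by rewrite oppr_gt0 ln_lt0 // divr_gt0 //= ltr_pdivrMr // mul1r (lt_le_trans eta1).
have [N [f [fN bad]]] := approximate_index hp (divr_gt0 (divr_gt0 e0 (ltr0Sn R 1)) etak).
have H := join_entropy_le hp pP fN eta01.
set c : R := N%:R * _ + _ in H.
set h : R := ln lam + _ - _ - _ in H.
have hle : h <= ln lam + mean_weight + e.
  move: bad; rewrite ler_pdivlMr // /h {1}/eta subKr expRK; lra.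
apply: le_trans hle.
have cR : (fun n : nat => h + c * n%:R^-1) @ \oo --> h.
  rewrite -[X in _ --> X]addr0 -(mulr0 c); apply: cvgD; first exact: cvg_cst.
  apply: cvgMr; apply/gtr0_cvgV0; last exact: cvgr_idn.
  by exists 1%N => // n /= n0; rewrite ltr0n.
rewrite -(cvg_lim (@Rhausdorff R) cR).
apply: ler_lim => //; first by apply/cvg_ex; exists h.
exists 1%N => // n /= n1.
rewrite ler_pdivrMr ?ltr0n // mulrDl -mulrA mulVf ?pnatr_eq0 -?lt0n //.
by rewrite mulr1 mulrC; exact: H.
Qed.

End EntropyUpperBound.

(** * Markov measures *)

Definition unit_lebesgue (R : realType) : set (measurableTypeR R) -> \bar R :=
  mrestr lebesgue_measure
    (measurable_itv `[(0 : R), 1[ : measurable ([set` _] : set (measurableTypeR R))).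
Arguments unit_lebesgue R _ : clear implicits.

HB.instance Definition _ (R : realType) := Measure.on (unit_lebesgue R).

Lemma unit_lebesgue_setT (R : realType) : unit_lebesgue R [set: _] = 1%E.
Proof.
by rewrite /unit_lebesgue /mrestr setTI lebesgue_measure_itv /= lte_fin ltr01 sube0.
Qed.

HB.instance Definition _ (R : realType) :=
  Measure_isProbability.Build _ _ _ (unit_lebesgue R) (unit_lebesgue_setT R).

Section Coding.
Context {R : realType} (m : seq 'I_3 -> R).
Hypothesis m_nil : m [::] = 1.
Hypothesis m_ge0 : forall s, 0 <= m s.
Hypothesis m_rcons : forall s, m s = \sum_a m (rcons s a).

(* The cylinders are laid out from left to right in [0, 1), in lexicographic
   order, the cylinder of s getting the interval [left_end s, left_end s + m s). *)
Definition left_end (s : seq 'I_3) : R :=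
  \sum_(i < size s) \sum_(a : 'I_3 | (a < nth ord0 s i)%N) m (rcons (take i s) a).

Lemma left_end_rcons (s : seq 'I_3) (b : 'I_3) :
  left_end (rcons s b) =
  left_end s + \sum_(a : 'I_3 | (a < b)%N) m (rcons s a).
Proof.
rewrite /left_end size_rcons big_ord_recr /= nth_rcons ltnn eqxx.
rewrite -cats1 take_size_cat //; congr (_ + _).
by apply: eq_bigr => i _; rewrite nth_cat ltn_ord takel_cat // ltnW.
Qed.

Definition code_interval (s : seq 'I_3) : set R :=
  [set` `[left_end s, left_end s + m s[].

Definition next_symbol (s : seq 'I_3) (x : R) : 'I_3 :=
  if x < left_end (rcons s 1) then 0
  else if x < left_end (rcons s (inord 2)) then 1 else inord 2.

Lemma ord3P (a : 'I_3) : [\/ a = 0, a = 1 | a = inord 2].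
Proof.
case: a => -[|[|[|//]]] i; [constructor 1|constructor 2|constructor 3];
  by apply: val_inj; rewrite /= ?inordK.
Qed.

Lemma code_interval_rcons (s : seq 'I_3) (a : 'I_3) (x : R) :
  code_interval (rcons s a) x <-> code_interval s x /\ next_symbol s x = a.
Proof.
have E1 : lift ord0 ord0 = 1 :> 'I_3 by exact: val_inj.
have E2 : lift ord0 (lift ord0 ord0) = inord 2 :> 'I_3.
  by apply: val_inj; rewrite /= inordK.
have E0 : ord0 = 0 :> 'I_3 by exact: val_inj.
have mE := m_rcons s.
rewrite !big_ord_recl !big_ord0 !E1 !E2 !E0 addr0 in mE.
rewrite /code_interval /next_symbol /= !in_itv /= !left_end_rcons.
rewrite !(big_mkcond (fun b : 'I_3 => _ < _)%N) /= !big_ord_recl !big_ord0 /=.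
rewrite !E1 !E2 !E0 /= !inordK //= {E0 E1 E2}.
have := m_ge0 (rcons s 0); have := m_ge0 (rcons s 1).
have := m_ge0 (rcons s (inord 2)).
move: mE; set m0 := m (rcons s 0); set m1 := m (rcons s 1).
set m2 := m (rcons s (inord 2)); set l := left_end s => mE h2 h1 h0.
have n01 : (0 : 'I_3) <> 1 by [].
have n02 : (0 : 'I_3) <> inord 2 by move=> /(congr1 val); rewrite /= inordK.
have n12 : (1 : 'I_3) <> inord 2 by move=> /(congr1 val); rewrite /= inordK.
have [->|->|->] := ord3P a; rewrite /= ?inordK //= mE -/m0 -/m1 -/m2 ?addr0 ?add0r;
  have [c1|c1] := ltP x (l + m0); have [c2|c2] := ltP x (l + (m0 + m1));
  (split=> [/andP[xa xb]|[/andP[xa xb] e]];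
    [first [split; [apply/andP; split; lra|reflexivity]|exfalso; lra]
    |first [by case: (n01 e)|by case: (n02 e)|by case: (n12 e)
           |by case: (n01 (esym e))|by case: (n02 (esym e))
           |by case: (n12 (esym e))|clear e; apply/andP; split; lra]]).
Qed.

Definition code_prefix (x : R) : nat -> seq 'I_3 :=
  fix f n := if n is n'.+1 then rcons (f n') (next_symbol (f n') x) else [::].

Definition code : measurableTypeR R -> Omega :=
  fun x n => next_symbol (code_prefix x n) x.

Lemma code_prefixE (x : R) (n : nat) : code_prefix x n = mkseq (code x) n.
Proof.
by elim: n => // n IH; rewrite mkseqS -IH.
Qed.

Lemma code_prefix_interval (x : R) (s : seq 'I_3) :
  0 <= x < 1 -> code_prefix x (size s) = s <-> code_interval s x.
Proof.
move=> x01; elim/last_ind: s => [|s a IH].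
  split=> // _; rewrite /code_interval /= in_itv /= /left_end big_ord0.
  by rewrite add0r m_nil.
rewrite code_interval_rcons -IH size_rcons /=; split=> [/rcons_inj[-> <-]//|].
by move=> [-> ->].
Qed.

Lemma measurable_left_ltr (c : R) : measurable [set x : measurableTypeR R | x < c].
Proof.
by rewrite (_ : [set x | _] = `]-oo, c[%classic).
Qed.

Lemma finite_rv_next_symbol (s : seq 'I_3) :
  @finite_rv _ (measurableTypeR R) 'I_3 (next_symbol s).
Proof.
have lt_rv c : @finite_rv _ (measurableTypeR R) bool (fun x : R => x < c).
  move=> [].
    by have := measurable_left_ltr c; congr measurable.
  have := measurableC (measurable_left_ltr c); congr measurable.
  by apply/seteqP; split=> x /=; [move=> /negP/negbTE|move=> ->].
exact: (finite_rv_comp (fun bb : bool * bool => if bb.1 then 0 else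
  if bb.2 then 1 else inord 2 : 'I_3) (finite_rv_pair (lt_rv _) (lt_rv _))).
Qed.

Lemma measurable_code_prefix (n : nat) (s : seq 'I_3) :
  measurable [set x : measurableTypeR R | code_prefix x n = s].
Proof.
elim: n s => [|n IH] s.
  have [->|/eqP s0] := eqVneq s [::].
    by rewrite (_ : [set x | _] = setT) //; apply/seteqP; split.
  by rewrite (_ : [set x | _] = set0) //; apply/seteqP; split=> // x /= /esym.
have [|s' a] := lastP s.
  rewrite (_ : [set x | _] = set0) //; apply/seteqP; split=> // x /=.
  by case: code_prefix.
rewrite (_ : [set x | _] =
  [set x | code_prefix x n = s'] `&` next_symbol s' @^-1` [set a]).
  by apply: measurableI => //; exact: finite_rv_next_symbol.
apply/seteqP; split=> x /=; first by move=> /rcons_inj[-> <-].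
by move=> [-> ->].
Qed.

Lemma measurable_code : measurable_fun [set: measurableTypeR R] code.
Proof.
apply: measurable_to_Omega => n a.
rewrite (_ : _ @^-1` _ = \bigcup_(s : seq 'I_3)
  ([set x | code_prefix x n = s] `&` next_symbol s @^-1` [set a])).
  apply: countable_bigcupT_measurable; first exact: countableP.
  move=> s; apply: measurableI; first exact: measurable_code_prefix.
  exact: finite_rv_next_symbol.
by apply/seteqP; split=> [x xa|x [s _ [<-]]//]; exists (code_prefix x n).
Qed.

Lemma code_interval_sub (s : seq 'I_3) : code_interval s `<=` [set` `[0, 1[].
Proof.
elim/last_ind: s => [|s a IH] x.
  by rewrite /code_interval /left_end big_ord0 m_nil add0r.
by move=> /code_interval_rcons[/IH].
Qed.

Lemma coded_measure_exists : exists mu : probability Omega R,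
  forall n (w : {ffun 'I_n -> 'I_3}),
    law mu (word n) w = m (mkseq (extend w) n).
Proof.
pose X : {mfun measurableTypeR R >-> Omega} := mfun_Sub (mem_set measurable_code).
exists (distribution (unit_lebesgue R) X) => n w.
set s : seq 'I_3 := mkseq (extend w) n.
have sn : size s = n by rewrite size_mkseq.
have E : (code @^-1` (word n @^-1` [set w])) `&` [set` `[0, 1[] = code_interval s.
  apply/seteqP; split=> x.
    move=> [/= xw]; rewrite in_itv => x01.
    rewrite -code_prefix_interval // sn code_prefixE /s -xw.
    by apply/eq_in_map => i; rewrite mem_iota add0n => /= ni; rewrite extend_word.
  move=> xs; have x01 := code_interval_sub xs; split=> //=.
  move: xs; rewrite -code_prefix_interval; last by move: x01; rewrite /= in_itv.
  rewrite sn code_prefixE => /eq_in_map xs; apply/ffunP => i.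
  by rewrite ffunE xs ?mem_iota ?add0n ?ltn_ord // extend_ord.
transitivity (fine (lebesgue_measure (code_interval s))).
  by rewrite -E.
rewrite /code_interval lebesgue_measure_itv /= lte_fin.
case: ifPn => [_|]; first by rewrite -EFinB /= addrC addKr.
rewrite -leNgt gerDl => ms.
by apply/eqP; rewrite eq_le m_ge0 ms.
Qed.

End Coding.

Lemma law_comp (R : realType) d (T : measurableType d) (mu : probability T R)
    (J K : finType) (X : T -> J) (h : J -> K) (k : K) :
  finite_rv X -> law mu (h \o X) k = \sum_j law mu X j * (h j == k)%:R.
Proof.
move=> hX; rewrite -(finite_rv_integral mu (fun j => (h j == k)%:R) hX).
rewrite (finite_rv_integral mu (fun l => (l == k)%:R) (finite_rv_comp h hX)).
rewrite (bigD1 k) //= eqxx mulr1 big1 ?addr0 // => l /negPf ->.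
by rewrite mulr0.
Qed.

Section Markov.
Context {R : realType} (q : 'I_3 -> R) (Q : 'I_3 -> 'I_3 -> R).
Hypothesis q_ge0 : forall a, 0 <= q a.
Hypothesis Q_ge0 : forall a b, 0 <= Q a b.
Hypothesis q_sum : \sum_a q a = 1.
Hypothesis Q_sum : forall a, \sum_b Q a b = 1.
Hypothesis q_stationary : forall b, \sum_a q a * Q a b = q b.

Fixpoint transition (a : 'I_3) (s : seq 'I_3) : R :=
  if s is b :: s' then Q a b * transition b s' else 1.

Definition markov_mass (s : seq 'I_3) : R :=
  if s is a :: s' then q a * transition a s' else 1.

Lemma transition_ge0 (a : 'I_3) (s : seq 'I_3) : 0 <= transition a s.
Proof. by elim: s a => //= b s IH a; rewrite mulr_ge0. Qed.

Lemma markov_mass_ge0 (s : seq 'I_3) : 0 <= markov_mass s.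
Proof. by case: s => //= a s; rewrite mulr_ge0 // transition_ge0. Qed.

Lemma transition_rcons (a : 'I_3) (s : seq 'I_3) :
  transition a s = \sum_b transition a (rcons s b).
Proof.
elim: s a => [|c s IH] a /=; last by rewrite IH mulr_sumr.
by rewrite -[LHS](Q_sum a); apply: eq_bigr => b _ /=; rewrite mulr1.
Qed.

Lemma markov_mass_rcons (s : seq 'I_3) :
  markov_mass s = \sum_a markov_mass (rcons s a).
Proof.
case: s => [|b s] /=; last by rewrite -mulr_sumr -transition_rcons.
by rewrite -[LHS]q_sum; apply: eq_bigr => a _ /=; rewrite mulr1.
Qed.

Lemma markov_mass_cons (s : seq 'I_3) :
  \sum_a markov_mass (a :: s) = markov_mass s.
Proof.
case: s => [|b s] /=.
  by rewrite -[RHS]q_sum; apply: eq_bigr => a _ /=; rewrite mulr1.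
by under eq_bigr do rewrite mulrA; rewrite -mulr_suml q_stationary.
Qed.

Lemma mkseq_prepend (n : nat) (a : 'I_3) (x : Omega) :
  mkseq (prepend a x) n.+1 = a :: mkseq x n.
Proof.
rewrite /mkseq /=.
have -> : iota 1 n = [seq (1 + i)%N | i <- iota 0 n] := iotaDl 1 0 n.
by rewrite -map_comp.
Qed.

Lemma markov_measure_exists : exists2 mu : probability Omega R,
  invariant_measure shift_map mu & forall n (w : {ffun 'I_n -> 'I_3}),
    law mu (word n) w = markov_mass (mkseq (extend w) n).
Proof.
have [mu muE] := coded_measure_exists (erefl : markov_mass [::] = 1)
  markov_mass_ge0 markov_mass_rcons.
exists mu => // B mB.
pose S : {mfun Omega >-> Omega} := mfun_Sub (mem_set measurable_shift_map).
rewrite -[LHS]/(distribution mu S B).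
apply: cylinder_measure_unique => // n w.
rewrite -[LHS]fineK ?fin_num_measure //; last exact: finite_rv_word.
rewrite -[RHS]fineK ?fin_num_measure //; last exact: finite_rv_word.
congr (_%:E); rewrite -[RHS]/(law mu (word n) w) muE.
pose h (v : {ffun 'I_n.+1 -> 'I_3}) := word n (shift_map (extend v)).
have hE : word n \o shift_map = h \o word n.+1.
  apply/funext => x; apply/ffunP => i; rewrite /h /= !ffunE.
  by rewrite /shift_map extend_word // ltnS.
rewrite -[LHS]/(law mu (word n \o shift_map) w) hE law_comp; last exact: finite_rv_word.
under eq_bigr do rewrite muE.
rewrite (sum_extend_recl n (fun y => markov_mass (mkseq y n.+1) *
  (word n (shift_map y) == w)%:R)).
rewrite -markov_mass_cons; apply: eq_bigr => a _.
have shE y : shift_map (prepend a y) = y by [].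
rewrite (bigD1 w) // shE word_extend eqxx mulr1 mkseq_prepend.
rewrite big1 => [|v /negPf vw]; first exact: addr0.
by rewrite shE word_extend vw mulr0.
Qed.

Let eta (x : R) : R := x * ln x.

Let eta1 : eta 1 = 0. Proof. by rewrite /eta ln1 mulr0. Qed.

Let etaM (x y : R) : 0 <= x -> 0 <= y -> eta (x * y) = eta x * y + x * eta y.
Proof.
rewrite /eta le_eqVlt => /predU1P[<-|x0]; first by rewrite !mul0r addr0.
rewrite le_eqVlt => /predU1P[<-|y0]; first by rewrite !(mul0r, mulr0) addr0.
by rewrite lnM ?posrE //; ring.
Qed.

Lemma sum_transition (n : nat) (a : 'I_3) :
  \sum_(v : {ffun 'I_n -> 'I_3}) transition a (mkseq (extend v) n) = 1.
Proof.
elim: n a => [|n IH] a.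
  rewrite (big_pred1 [ffun=> ord0]) // => v.
  by apply/esym/eqP/ffunP => -[].
rewrite (sum_extend_recl n (fun y => transition a (mkseq y n.+1))).
rewrite -[RHS](Q_sum a); apply: eq_bigr => b _.
under eq_bigr do rewrite mkseq_prepend /=.
by rewrite -mulr_sumr IH mulr1.
Qed.

Definition markov_entropy : R :=
  - \sum_a q a * \sum_b Q a b * ln (Q a b).

Lemma sum_eta_transition (n : nat) :
  \sum_a q a * \sum_(v : {ffun 'I_n -> 'I_3})
    eta (transition a (mkseq (extend v) n)) = - (n%:R * markov_entropy).
Proof.
elim: n => [|n IH].
  rewrite mul0r oppr0 big1 // => a _.
  by rewrite big1 ?mulr0 // => v _; rewrite eta1.
rewrite -natr1 mulrDl mul1r opprD -IH /markov_entropy opprK addrC.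
under [X in _ + X]eq_bigr do rewrite -q_stationary mulr_suml.
rewrite [X in _ + X]exchange_big -big_split /=; apply: eq_bigr => a _.
under [X in _ + X]eq_bigr do rewrite -mulrA.
rewrite -mulr_sumr -mulrDr; congr (_ * _).
rewrite (sum_extend_recl n (fun y => eta (transition a (mkseq y n.+1)))).
rewrite -big_split; apply: eq_bigr => b _.
under [LHS]eq_bigr do rewrite mkseq_prepend /= etaM ?transition_ge0 //.
by rewrite big_split /= -!mulr_sumr sum_transition mulr1.
Qed.

Lemma markov_pressure_ge (b : R) (eps : 'I_3 -> 'I_3 -> R) :
  ((markov_entropy - b * \sum_i \sum_j q i * Q i j * eps i j)%:E <=
   pressure shift_map (potential eps) b)%E.
Proof.
have [mu mu_inv muE] := markov_measure_exists.
pose X (x : Omega) : 'I_3 := x 0%N.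
have hX : finite_rv X by exact: finite_rv_coordinate.
pose P (j : 'I_3) : set Omega := X @^-1` [set j].
have mP : measurable_partition P.
  split=> //.
    by move=> i j _ _ [x [/= <- <-]].
  by apply/seteqP; split=> // x _; exists (X x).
have HE n : join_entropy shift_map mu P n.+1 =
    n%:R * markov_entropy - \sum_a eta (q a).
  rewrite /join_entropy.
  under eq_bigr do rewrite (@law_join_cell R _ _ mu shift_map _ n.+1 P X (fun=> erefl)).
  rewrite (_ : (fun x => [ffun i : 'I_n.+1 => X (iter i shift_map x)]) = word n.+1);
    last by apply/funext => x; apply/ffunP => i; rewrite !ffunE /X iter_shift_mapE addn0.
  under eq_bigr do rewrite muE -/(eta _).
  rewrite (sum_extend_recl n (fun y => eta (markov_mass (mkseq y n.+1)))).
  rewrite -[_ * markov_entropy]opprK -sum_eta_transition -opprD; congr (- _).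
  rewrite addrC -big_split; apply: eq_bigr => a _.
  under [LHS]eq_bigr do rewrite mkseq_prepend /= etaM ?transition_ge0 //.
  by rewrite big_split /= -!mulr_sumr sum_transition mulr1.
have hE : partition_entropy shift_map mu P = markov_entropy.
  apply: cvg_lim => //; rewrite -(cvg_shiftS _).
  pose c := \sum_a eta (q a) + markov_entropy.
  have c0 : (fun n : nat => markov_entropy - c * n.+1%:R^-1) @ \oo -->
      markov_entropy - c * 0.
    by apply: cvgB; [exact: cvg_cst|apply: cvgMr; exact: cvg_harmonic].
  rewrite mulr0 subr0 in c0.
  rewrite (_ : (fun n => _) = (fun n : nat => markov_entropy - c * n.+1%:R^-1)) //.
  apply/funext => n /=; rewrite HE /c -natr1; field.
  by rewrite natr1 pnatr_eq0.
have IE : (\int[mu]_x (potential eps x)%:E)%E =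
    (- \sum_i \sum_j q i * Q i j * eps i j)%:E.
  pose phi (w : {ffun 'I_2 -> 'I_3}) : R := - eps (extend w 0%N) (extend w 1%N).
  have hw := @finite_rv_word 2.
  have pE x : potential eps x = phi (word 2 x).
    by rewrite /potential /phi !extend_word.
  have := finite_rv_integral mu phi hw.
  rewrite /Rintegral (eq_integral (fun x => (potential eps x)%:E)); last first.
    by move=> x _; rewrite pE.
  move=> E; rewrite -[LHS]fineK; last first.
    apply: integrable_fin_num => //.
    have := finite_rv_integrable mu phi hw.
    by congr integrable; apply/funext => x /=; rewrite pE.
  rewrite E; congr (_%:E).
  under eq_bigr do rewrite muE.
  rewrite (sum_extend_recl 1 (fun y => markov_mass (mkseq y 2) * - eps (y 0%N) (y 1%N))).
  rewrite -sumrN; apply: eq_bigr => i _.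
  rewrite (sum_extend_recl 0 (fun y => markov_mass (mkseq (prepend i y) 2) *
    - eps (prepend i y 0%N) (prepend i y 1%N))).
  rewrite -sumrN; apply: eq_bigr => j _.
  rewrite (big_pred1 [ffun=> ord0]) /=; last first.
    by move=> v; apply/esym/eqP/ffunP => -[].
  by rewrite mulr1 mulrN.
apply: ereal_sup_ge; exists (KS_entropy shift_map mu +
  b%:E * \int[mu]_x (potential eps x)%:E)%E; first by exists mu.
rewrite IE -EFinM mulrN EFinB leeD2r //.
apply: ereal_sup_ge; exists (partition_entropy shift_map mu P)%:E.
  by exists 3%N, P.
by rewrite hE.
Qed.

End Markov.

(** * Bounds on the pressure *)

Lemma sum_ord3 (V : nmodType) (F : 'I_3 -> V) :
  \sum_a F a = F 0 + F 1 + F (inord 2).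
Proof.
rewrite !big_ord_recl big_ord0 addr0 addrA; congr (F _ + F _ + F _);
  by apply: val_inj; rewrite /= ?inordK.
Qed.

Lemma ord3_neq : [/\ (0 : 'I_3) != 1, (0 : 'I_3) != inord 2 &
  (1 : 'I_3) != inord 2].
Proof. by split; rewrite -val_eqE /= ?inordK. Qed.

Section PressureBounds.
Context {R : realType} (eps : 'I_3 -> 'I_3 -> R).
Hypothesis eps00 : eps 0 0 = 0.
Hypothesis eps11 : eps 1 1 = 0.
Hypothesis eps_gt0 : forall i j : 'I_3,
  (i, j) <> (0, 0) -> (i, j) <> (1, 1) -> 0 < eps i j.

Lemma eps_ge0 (i j : 'I_3) : 0 <= eps i j.
Proof.
have [[-> ->]|h0] := pselect ((i, j) = (0, 0)); first by rewrite eps00.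
have [[-> ->]|h1] := pselect ((i, j) = (1, 1)); first by rewrite eps11.
exact/ltW/eps_gt0.
Qed.

Lemma pressure_le_ln (b : R) (u : 'I_3 -> R) (lam : R) :
  0 < b -> 1 <= lam -> (forall a, 0 < u a) ->
  (forall a, \sum_c expR (- (b * eps a c)) * u c <= lam * u a) ->
  (pressure shift_map (potential eps) b <= (ln lam)%:E)%E.
Proof.
move=> b0 lam1 u0 Mu; apply: ge_ereal_sup => _ [mu [mu_inv ->]].
have hX : finite_rv (fun x : Omega => (x 0%N : 'I_3, x 1%N : 'I_3)).
  by apply: finite_rv_pair; exact: finite_rv_coordinate.
have iA : mu.-integrable [set: Omega] (EFin \o potential eps).
  exact: (finite_rv_integrable mu (fun ij => - eps ij.1 ij.2) hX).
have fA := integrable_fin_num measurableT iA.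
set IA := \int[mu]_x potential eps x.
have IAE : (\int[mu]_x (potential eps x)%:E)%E = IA%:E by rewrite /IA fineK.
have IA_le0 : IA <= 0.
  rewrite -oppr_ge0 -mulN1r -RintegralZl //; apply: Rintegral_ge0 => x _.
  by rewrite mulN1r opprK eps_ge0.
pose M (a c : 'I_3) := expR (- (b * eps a c)).
have mwE : mean_weight mu M = - (b * IA).
  rewrite -mulNr -RintegralZl //; apply: eq_Rintegral => x _.
  by rewrite /M expRK /potential mulrNN opprK.
have lam0 : 0 < lam by exact: lt_le_trans lam1.
have ln0 : 0 <= ln lam by rewrite ln_ge0.
rewrite IAE -EFinM -leeBrDr // -EFinB.
apply: ge_ereal_sup => _ [k [P [mP ->]]]; rewrite lee_fin.
have [cP|/dvgP dP] := pselect (cvgn (fun n => join_entropy shift_map mu P n / n%:R)).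
  rewrite -mwE; apply: (partition_entropy_le _ lam0 u0 Mu mu_inv mP cP).
  by move=> a c; exact: expR_gt0.
(* The limit of a divergent sequence is the junk value 0, which is harmless
   here. *)
rewrite /partition_entropy dP; apply: (@le_trans _ _ 0) => //.
by rewrite subr_ge0 (le_trans _ ln0) // mulr_ge0_le0 // ltW.
Qed.

Definition escape_factor (b : R) : R := 2 / (1 - expR (- (b * eps (inord 2) (inord 2)))).

Lemma escape_factor_gt0 (b : R) : 0 < b -> 0 < escape_factor b.
Proof.
move=> b0; rewrite divr_gt0 // subr_gt0 -expR0 ltr_expR oppr_lt0 mulr_gt0 //.
have [_ n02 n12] := ord3_neq.
by apply: eps_gt0 => -[/eqP]; rewrite eq_sym ?(negPf n02) ?(negPf n12).
Qed.

Lemma pressure_le (b rho : R) : 0 < b ->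
  rho <= eps 0 (inord 2) + eps (inord 2) 0 ->
  rho <= eps 1 (inord 2) + eps (inord 2) 1 ->
  2 * rho <= eps 0 1 + eps 1 0 ->
  2 * rho <= eps 0 (inord 2) + eps (inord 2) 1 + eps 1 0 ->
  2 * rho <= eps 0 1 + eps 1 (inord 2) + eps (inord 2) 0 ->
  (pressure shift_map (potential eps) b <=
   ((1 + escape_factor b) * expR (- (rho * b)))%:E)%E.
Proof.
move=> b0 h1 h2 h3 h4 h5.
have K0 := escape_factor_gt0 b0.
have [n01 n02 n12] := ord3_neq.
set K := escape_factor b in K0 *.
set E := expR (- (rho * b)); have E0 : 0 < E by exact: expR_gt0.
set lam := 1 + (1 + K) * E.
have lamE : 0 < (1 + K) * E by rewrite mulr_gt0 // addr_gt0.
have lam1 : 1 <= lam by rewrite lerDl ltW.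
apply: (@le_trans _ _ (ln lam)%:E); last first.
  by rewrite lee_fin le_ln1Dx // (lt_trans _ lamE) // ltrN10.
set a := Num.min (eps 0 1) (eps 0 (inord 2) + eps (inord 2) 1).
pose t := rho - a.
pose s := Num.min (eps (inord 2) 0) (eps (inord 2) 1 + t).
have [a1 a2] : a <= eps 0 1 /\ a <= eps 0 (inord 2) + eps (inord 2) 1.
  by split; rewrite /a ge_min lexx ?orbT.
have a3 : a = eps 0 1 \/ a = eps 0 (inord 2) + eps (inord 2) 1.
  by rewrite /a; case: leP; [left|right].
have [s1 s2] : s <= eps (inord 2) 0 /\ s <= eps (inord 2) 1 + t.
  by split; rewrite /s ge_min lexx ?orbT.
have s3 : s = eps (inord 2) 0 \/ s = eps (inord 2) 1 + t.
  by rewrite /s; case: leP; [left|right].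
pose u (c : 'I_3) : R := if c == 0 then 1 else if c == 1 then expR (- (b * t))
  else K * expR (- (b * s)).
have u0 : u 0 = 1 by rewrite /u eqxx.
have u1 : u 1 = expR (- (b * t)) by rewrite /u eq_sym (negPf n01) eqxx.
have u2 : u (inord 2) = K * expR (- (b * s)).
  by rewrite /u eq_sym (negPf n02) eq_sym (negPf n12).
have le_exp (x y : R) : y <= x -> expR (- (b * x)) <= expR (- (b * y)).
  by move=> xy; rewrite ler_expR lerN2 ler_pM2l.
have exp_add (x y : R) : expR (- (b * x)) * expR (- (b * y)) = expR (- (b * (x + y))).
  by rewrite -expRD; congr expR; ring.
have EE : E = expR (- (b * rho)) by rewrite /E mulrC.
apply: (pressure_le_ln (u := u)) => // c.
  rewrite /u; case: ifP => // _; case: ifP => _; first exact: expR_gt0.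
  by apply: mulr_gt0 => //; exact: expR_gt0.
rewrite sum_ord3 u0 u1 u2.
have [->|->|->] := ord3P c.
- rewrite u0 eps00 mulr0 oppr0 expR0 exp_add mulrCA exp_add /lam !mulr1.
  rewrite -addrA lerD2l mulrDl mul1r EE lerD //.
    by apply: le_exp; rewrite /t; lra.
  by rewrite ler_pM2l //; apply: le_exp; rewrite /t in s3 *; lra.
- rewrite u1 eps11 mulr0 oppr0 expR0 mulr1 mul1r mulrCA exp_add /lam.
  rewrite mulrDl mul1r -mulrA EE exp_add [_ + expR (- (b * t))]addrC -addrA lerD2l.
  rewrite [leRHS]mulrDl mul1r lerD //.
    by apply: le_exp; rewrite /t; lra.
  by rewrite ler_pM2l //; apply: le_exp; rewrite /t in s3 *; lra.
- rewrite u2 mulr1 exp_add.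
  apply: (@le_trans _ _ (K * expR (- (b * s)))); last first.
    by rewrite ler_peMl // mulr_ge0 ?expR_ge0 // ltW.
  set x := expR (- (b * eps (inord 2) (inord 2))).
  have x1 : 1 - x != 0.
    by move: K0; rewrite /K /escape_factor -/x; apply: contraTneq => ->;
      rewrite invr0 mulr0 ltxx.
  have KE : K * expR (- (b * s)) = expR (- (b * s)) + expR (- (b * s)) +
      x * (K * expR (- (b * s))).
    by rewrite /K /escape_factor -/x; field.
  by rewrite [leRHS]KE lerD2r lerD // le_exp.
Qed.


Lemma pressure_ge (b : R) (s : 'I_3 -> 'I_3) (n C : R) : 0 < b -> injective s ->
  n = (s 0 != 0)%:R + (s 1 != 1)%:R -> 1 <= n ->
  C = \sum_a (s a != a)%:R * eps a (s a) ->
  ((expR (- (b * (C / n) + 1)) / 2)%:E <=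
   pressure shift_map (potential eps) b)%E.
Proof.
move=> b0 s_inj nE n1 CE; have [n01 n02 n12] := ord3_neq.
have n0 : 0 < n by exact: lt_le_trans n1.
have C0 : 0 <= C.
  by rewrite CE sumr_ge0 // => a _; rewrite mulr_ge0 ?ler0n ?eps_ge0.
set p := expR (- (b * (C / n) + 1)).
have p0 : 0 < p by exact: expR_gt0.
have bCn : 0 <= b * (C / n) by rewrite mulr_ge0 ?divr_ge0 // ltW.
have p1 : p <= 1 by rewrite /p -expR0 ler_expR oppr_le0 addr_ge0.
have lnp : ln p = - (b * (C / n) + 1) by rewrite /p expRK.
pose moved (a : 'I_3) : R := (s a != a)%:R.
(* A symbol of zero energy is left with probability p, the third symbol at
   once, so that all the moves of the cycle carry the same flow p / Z. *)
pose leave (a : 'I_3) : R := if a == inord 2 then 1 else p.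
pose w (a : 'I_3) : R := if a == inord 2 then p else 1.
have wl a : w a * leave a = p.
  by rewrite /w /leave; case: ifP; rewrite ?mulr1 ?mul1r.
have leave01 a : 0 < leave a <= 1.
  by rewrite /leave; case: ifP; rewrite ?ltr01 ?lexx ?p0.
have w0 a : 0 < w a by rewrite /w; case: ifP.
have moved01 a : 0 <= moved a <= 1.
  by rewrite /moved; case: (_ != _); rewrite /= ?lexx ?ler01.
pose Z := \sum_a moved a * w a.
have ZE : Z = n + moved (inord 2) * p.
  by rewrite /Z sum_ord3 /w (negPf n02) (negPf n12) eqxx !mulr1 nE.
have Z_gt0 : 0 < Z.
  have /andP[m0 _] := moved01 (inord 2).
  by rewrite ZE ltr_wpDr // mulr_ge0 // ltW.
have Z_le : Z <= 2 * n.
  have /andP[m0 m1] := moved01 (inord 2).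
  have : moved (inord 2) * p <= 1 by rewrite mulr_ile1 // ltW.
  by rewrite ZE; lra.
pose q a := moved a * w a / Z.
pose Q a c := (1 - leave a) * (a == c)%:R + leave a * (s a == c)%:R.
have q_ge0 a : 0 <= q a.
  have /andP[m0 _] := moved01 a.
  by apply: divr_ge0; [apply: mulr_ge0 => //|]; exact/ltW.
have Q_ge0 a c : 0 <= Q a c.
  have /andP[l0 l1] := leave01 a.
  by rewrite /Q addr_ge0 // mulr_ge0 ?ler0n // ?subr_ge0 // ltW.
have sum_pick (F : 'I_3 -> R) a : \sum_c (a == c)%:R * F c = F a.
  rewrite (bigD1 a) //= eqxx mul1r big1 ?addr0 // => c /negPf.
  by rewrite eq_sym => ->; rewrite mul0r.
have Q_mean (F : 'I_3 -> R) a :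
    \sum_c Q a c * F c = (1 - leave a) * F a + leave a * F (s a).
  under eq_bigr do rewrite /Q mulrDl -!mulrA.
  by rewrite big_split /= -!mulr_sumr !sum_pick.
have q_sum : \sum_a q a = 1 by rewrite /q -mulr_suml divff // gt_eqF.
have Q_sum a : \sum_c Q a c = 1.
  have := Q_mean (fun=> 1) a; under eq_bigr do rewrite mulr1.
  by move=> ->; ring.
have flow a : q a * leave a = moved a * p / Z by rewrite -(wl a) /q; ring.
have q_stat c : \sum_a q a * Q a c = q c.
  have [s' sK s'K] := injF_bij s_inj.
  have -> : c = s (s' c) by rewrite s'K.
  move: (s' c) => {}c.
  under eq_bigr do rewrite /Q mulrDr !mulrA flow (inj_eq s_inj) mulrBr mulr1 flow.
  rewrite big_split /=.
  have pickr (F : 'I_3 -> R) e : \sum_a F a * (a == e)%:R = F e.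
    rewrite -[RHS](sum_pick F); apply: eq_bigr => a _.
    by rewrite mulrC eq_sym.
  have moved_s : moved (s c) = moved c by rewrite /moved (inj_eq s_inj).
  by rewrite !pickr moved_s subrK.
apply: le_trans (markov_pressure_ge q_ge0 Q_ge0 q_sum Q_sum q_stat b eps).
rewrite lee_fin.
have eta_le0 (x : R) : 0 <= x -> x <= 1 -> x * ln x <= 0.
  by move=> x0 x1; rewrite mulr_ge0_le0 // ln_le0.
have Q_le1 a c : Q a c <= 1.
  by rewrite -(Q_sum a) (bigD1 c) //= lerDl sumr_ge0.
have hE : p / Z * (n * (b * (C / n) + 1)) <= markov_entropy q Q.
  rewrite /markov_entropy -sumrN.
  apply: (@le_trans _ _ (\sum_a p / Z * (moved a * - ln (leave a)))).
    rewrite -mulr_sumr ler_pM2l ?divr_gt0 // sum_ord3 /leave.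
    rewrite (negPf n02) (negPf n12) eqxx ln1 oppr0 mulr0 addr0 -mulrDl -nE.
    by rewrite lnp opprK.
  apply: ler_sum => a _.
  have -> : p / Z * (moved a * - ln (leave a)) = q a * - (leave a * ln (leave a)).
    by rewrite [RHS]mulrN [in RHS]mulrA flow; ring.
  have [sa|sa] := eqVneq (s a) a.
    by rewrite /q /moved sa eqxx !mul0r oppr0.
  have Qs : Q a (s a) = leave a.
    by rewrite /Q eqxx mulr1 eq_sym (negPf sa) mulr0 add0r.
  rewrite -[leRHS]mulrN ler_wpM2l // lerN2 (bigD1 (s a)) //= Qs gerDl.
  by apply: sumr_le0 => c _; exact: eta_le0.
have CE' : \sum_i \sum_j q i * Q i j * eps i j = p / Z * C.
  rewrite CE mulr_sumr; apply: eq_bigr => a _.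
  under eq_bigr do rewrite -mulrA.
  rewrite -mulr_sumr Q_mean (_ : (1 - leave a) * eps a a = 0).
    by rewrite add0r mulrA flow -/(moved a); ring.
  rewrite /leave; have [->|->|->] := ord3P a; rewrite ?eps00 ?eps11 ?mulr0 //.
  by rewrite eqxx subrr mul0r.
rewrite CE'; apply: le_trans (lerB hE (lexx _)).
have -> : p / Z * (n * (b * (C / n) + 1)) - b * (p / Z * C) = p * (n / Z).
  by field; rewrite !gt_eqF.
by rewrite ler_pM2l // ler_pdivlMr // mulrC ler_pdivrMr // mulrC.
Qed.

End PressureBounds.

Section CriticalExponent.
Context {R : realType} (eps : 'I_3 -> 'I_3 -> R).
Hypothesis eps00 : eps 0 0 = 0.
Hypothesis eps11 : eps 1 1 = 0.
Hypothesis eps_gt0 : forall i j : 'I_3,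
  (i, j) <> (0, 0) -> (i, j) <> (1, 1) -> 0 < eps i j.

(* The mean energy, per visit to the symbols 1 and 2, of the five nontrivial
   permutations of the alphabet. *)
Definition critical_exponent : R :=
  Num.min (eps 0 (inord 2) + eps (inord 2) 0)
  (Num.min (eps 1 (inord 2) + eps (inord 2) 1)
  (Num.min ((eps 0 1 + eps 1 0) / 2)
  (Num.min ((eps 0 (inord 2) + eps 1 0 + eps (inord 2) 1) / 2)
           ((eps 0 1 + eps 1 (inord 2) + eps (inord 2) 0) / 2)))).

Lemma critical_exponent_gt0 : 0 < critical_exponent.
Proof.
have [n01 n02 n12] := ord3_neq.
have off (i j : 'I_3) : i != j -> 0 < eps i j.
  by move=> /eqP ij; apply: eps_gt0 => -[hi hj]; apply: ij; rewrite hi hj.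
have p01 := off _ _ n01; have p02 := off _ _ n02; have p12 := off _ _ n12.
rewrite eq_sym in n01; rewrite eq_sym in n02; rewrite eq_sym in n12.
have p10 := off _ _ n01; have p20 := off _ _ n02; have p21 := off _ _ n12.
by rewrite /critical_exponent !lt_min; do ?[apply/andP; split]; lra.
Qed.

Lemma pressure_le_critical (b : R) : 0 < b ->
  (pressure shift_map (potential eps) b <=
   ((1 + escape_factor eps b) * expR (- (critical_exponent * b)))%:E)%E.
Proof.
move=> b0; have : critical_exponent <= critical_exponent by [].
rewrite {2}/critical_exponent !le_min => /and5P[h1 h2 h3 h4 h5].
by apply: pressure_le => //; lra.
Qed.

Lemma escape_factor_le (b b' : R) : 0 < b -> b <= b' ->
  escape_factor eps b' <= escape_factor eps b.
Proof.
move=> b0 bb'; have b'0 := lt_le_trans b0 bb'.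
have := escape_factor_gt0 eps_gt0 b0; have := escape_factor_gt0 eps_gt0 b'0.
rewrite /escape_factor !pmulr_rgt0 // !invr_gt0 => h' h.
rewrite ler_pM2l // lef_pV2 ?posrE // lerD2l lerN2 ler_expR lerN2.
by rewrite ler_wpM2r // eps_ge0.
Qed.

Lemma pressure_ge_cycle (x y z : 'I_3) (b n C : R) : 0 < b ->
  [/\ x != y, x != z & y != z] ->
  n = (x != 0)%:R + (y != 1)%:R -> 1 <= n ->
  C = (x != 0)%:R * eps 0 x + (y != 1)%:R * eps 1 y +
      (z != inord 2)%:R * eps (inord 2) z ->
  ((expR (- (b * (C / n) + 1)) / 2)%:E <=
   pressure shift_map (potential eps) b)%E.
Proof.
move=> b0 [xy xz yz] nE n1 CE; have [n01 n02 n12] := ord3_neq.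
pose s (a : 'I_3) := if a == 0 then x else if a == 1 then y else z.
have s0 : s 0 = x by rewrite /s eqxx.
have s1 : s 1 = y by rewrite /s eq_sym (negPf n01) eqxx.
have s2 : s (inord 2) = z by rewrite /s eq_sym (negPf n02) eq_sym (negPf n12).
apply: (pressure_ge eps00 eps11 eps_gt0 (s := s)) => //.
- move=> a c; have [->|->|->] := ord3P a; have [->|->|->] := ord3P c;
    rewrite ?s0 ?s1 ?s2 // => /eqP;
    by rewrite ?(negPf xy) ?(negPf xz) ?(negPf yz) // eq_sym
      ?(negPf xy) ?(negPf xz) ?(negPf yz).
- by rewrite sum_ord3 s0 s1 s2.
Qed.

Lemma pressure_ge_critical (b : R) : 0 < b ->
  ((expR (- (b * critical_exponent + 1)) / 2)%:E <=
   pressure shift_map (potential eps) b)%E.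
Proof.
move=> b0; have [n01 n02 n12] := ord3_neq.
have [n10 n20 n21] : [/\ (1 : 'I_3) != 0, (inord 2 : 'I_3) != 0 & (inord 2 : 'I_3) != 1].
  by split; rewrite eq_sym.
pose lower r := ((expR (- (b * r + 1)) / 2)%:E <=
  pressure shift_map (potential eps) b)%E.
have lower_min x y : lower x -> lower y -> lower (Num.min x y).
  by move=> hx hy; case: leP.
have lower_cycle x y z n C := @pressure_ge_cycle x y z b n C b0.
rewrite -/(lower critical_exponent) /critical_exponent.
apply: (lower_min); last apply: (lower_min); last apply: (lower_min);
  last apply: (lower_min).
- rewrite -[X in lower X]divr1; apply: (lower_cycle (inord 2) 1 0) => //;
    by rewrite ?n20 ?eqxx ?n02 /= ?(mul1r, mul0r, addr0, add0r).
- rewrite -[X in lower X]divr1; apply: (lower_cycle 0 (inord 2) 1) => //;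
    by rewrite ?n21 ?eqxx ?n12 /= ?(mul1r, mul0r, addr0, add0r).
- apply: (lower_cycle 1 0 (inord 2)) => //;
    by rewrite ?n10 ?n01 ?eqxx ?ler1n /= ?(mul1r, mul0r, addr0, add0r).
- apply: (lower_cycle (inord 2) 0 1) => //;
    by rewrite ?n20 ?n01 ?n12 ?ler1n /= ?(mul1r, mul0r, addr0, add0r).
- apply: (lower_cycle 1 (inord 2) 0) => //;
    by rewrite ?n10 ?n21 ?n02 ?ler1n /= ?(mul1r, mul0r, addr0, add0r).
Qed.

End CriticalExponent.

Theorem proposition7p1 (R : realType) (eps : 'I_3 -> 'I_3 -> R)
    (heps11 : eps 0 0 = 0) (heps22 : eps 1 1 = 0)
    (heps_pos : forall i j : 'I_3,
      (i, j) <> (0, 0) -> (i, j) <> (1, 1) -> 0 < eps i j) :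
  exists (g : R -> R) (rho : R),
    [/\ forall b : R, 0 < b -> 0 < g b,
        subexponential g,
        0 < rho &
        forall b : R, 0 < b ->
          pressure shift_map (potential eps) b = (g b * expR (- (rho * b)))%:E].
Proof.
set rho := critical_exponent eps.
pose P b := pressure shift_map (potential eps) b.
pose g b := fine (P b) * expR (rho * b).
have P_le b (b0 : 0 < b) := pressure_le_critical heps11 heps22 heps_pos b0.
have P_ge b (b0 : 0 < b) := pressure_ge_critical heps11 heps22 heps_pos b0.
have P_fin b : 0 < b -> P b \is a fin_num.
  move=> b0; rewrite fin_numE; apply/andP; split; rewrite -?ltNye -?ltey.
    by apply: lt_le_trans (P_ge b b0); exact: ltNyr.
  by apply: le_lt_trans (P_le b b0) _; exact: ltry.
have PE b : 0 < b -> P b = (g b * expR (- (rho * b)))%:E.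
  by move=> b0; rewrite /g -mulrA -expRD subrr expR0 mulr1 fineK ?P_fin.
have g_ge b : 0 < b -> expR (- 1) / 2 <= g b.
  move=> b0; have := P_ge b b0; rewrite -/(P b) PE // lee_fin -/rho.
  have -> : expR (- (b * rho + 1)) / 2 = expR (- 1) / 2 * expR (- (rho * b)).
    by rewrite opprD expRD (mulrC b); ring.
  by rewrite ler_pM2r ?expR_gt0.
have g_le b : 0 < b -> g b <= 1 + escape_factor eps b.
  move=> b0; have := P_le b b0; rewrite -/(P b) PE // lee_fin.
  by rewrite ler_pM2r ?expR_gt0.
exists g, rho; split => //; last exact: critical_exponent_gt0.
  by move=> b b0; apply: lt_le_trans (g_ge b b0); rewrite divr_gt0 ?expR_gt0.
have g0 b : 0 < b -> 0 < g b.
  by move=> b0; apply: lt_le_trans (g_ge b b0); rewrite divr_gt0 ?expR_gt0.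
pose c0 : R := ln (expR (- 1) / 2); pose c1 : R := ln (1 + escape_factor eps 1).
have inv0 : (b : R)^-1 @[b --> +oo] --> (0 : R).
  apply/gtr0_cvgV0; last exact: cvg_id.
  by exists 0; split=> // b.
have cvg_c (c : R) : b^-1 * c @[b --> +oo] --> (0 : R).
  by rewrite -[X in _ --> X](mul0r c); apply: cvgMl.
apply: (squeeze_cvgr _ (cvg_c c0) (cvg_c c1)).
exists 1; split=> // b b1.
have b0 : 0 < b by exact: lt_trans b1.
have bV : 0 < b^-1 by rewrite invr_gt0.
have e0 : 0 < expR (- 1) / 2 :> R by rewrite divr_gt0 ?expR_gt0.
have gb := g0 b b0.
have le_c1 : g b <= 1 + escape_factor eps 1.
  by apply: (le_trans (g_le b b0)); rewrite lerD2l escape_factor_le // ltW.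
apply/andP; split; rewrite ler_pM2l // ler_ln ?posrE ?g_ge //.
exact: lt_le_trans le_c1.
Qed.
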